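(* Let $\sigma$ be a probability measure with $\sigma([0,1])=1$. (1) Suppose that $\sigma$ is absolutely continuous with a density which is essentially bounded by $M$. Then for each integer $k\ge2$, $$n_\sigma(k)\le\left\lceil 75e^4\,kM\,(12eM)^{k-1}\right\rceil.$$ (2) Suppose that $R_\sigma(\delta)\ge c\,\delta^{\beta}$ for some $c>0$, $\beta\ge1$ and all $0<\delta<1$. Then for each integer $k\ge2$, $$n_\sigma(k)\le\left\lceil \alpha^k (k+3)^{(\beta-1)k+1}\right\rceil,$$ where $\alpha>0$ depends only on $c$ and $\beta$. Furthermore, in both cases all quadrature nodes lie in $[0,1]$; that is, for every integer $n$ at least the stated bound there is a Chebyshev-type quadrature for $\sigma$ of degree at least $k$ with exactly $n$ nodes, all in $[0,1]$.
   Context: For a probability measure $\sigma$ on $\mathbb{R}$, a Chebyshev-type quadrature of degree at least $k$ with $n$ nodes consists of points $x_1,\dots,x_n\in\mathbb{R}$, not necessarily distinct, with $\int x^j d\sigma(x)=\frac1n\sum_{i=1}^n x_i^j$ for all $0\le j\le k$. $n_\sigma(k)$ is the minimal integer such that for every $n\ge n_\sigma(k)$ there exists a Chebyshev-type quadrature for $\sigma$ of degree at least $k$ having exactly $n$ nodes ($\infty$ if no such integer exists). For $0<\delta<1$, $R_\sigma(\delta):=\min\left(|x-y|\ :\ x,y\in\mathbb{R},\ \sigma([x,y])\ge\delta\right)$. *)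

(* Defs.v *)
From HB Require Import structures.
From mathcomp Require Import all_boot all_order all_algebra.
From mathcomp Require Import all_classical all_reals all_analysis.

Set Implicit Arguments.
Unset Strict Implicit.
Unset Printing Implicit Defensive.

Import Order.TTheory GRing.Theory Num.Theory.
Import numFieldNormedType.Exports.

Local Open Scope classical_set_scope.
Local Open Scope ring_scope.

Section chebyshev_type_quadrature.
Context {R : realType}.
Implicit Type sigma : probability (measurableTypeR R) R.

(* The nodes x_1, ..., x_n may coincide. The integral is extended-real-valued;
   being equal to a finite number, it is a convergent one. For n = 0 the
   equation fails at j = 0 (it reads 1 = 0), so there are no quadratures
   without nodes. *)
Definition chebyshev_quadrature sigma (k n : nat) (x : 'I_n -> R) : Prop :=
  forall j : nat, (j <= k)%N ->
    (\int[sigma]_t (t ^+ j)%:E = (n%:R^-1 * \sum_(i < n) x i ^+ j)%:E)%E.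

(* A nonempty set of natural numbers contains its infimum, and
   ereal_inf set0 = +oo. *)
Definition min_nodes sigma (k : nat) : \bar R :=
  ereal_inf [set N%:R%:E | N in [set N : nat |
    forall n : nat, (N <= n)%N ->
      exists x : 'I_n -> R, chebyshev_quadrature sigma k x]].

(* For 0 < delta < 1 the set is nonempty and the infimum is attained.
   `[x, y] is empty when y < x, but then its measure is 0 < delta. *)
Definition min_width sigma (delta : R) : R :=
  inf [set r | exists x y : R,
    r = `|x - y| /\ (delta%:E <= sigma `[x, y]%classic)%E].

End chebyshev_type_quadrature.

(* Main.v *)
Require Import Defs.
From HB Require Import structures.
From mathcomp Require Import all_boot all_order all_algebra.
From mathcomp Require Import all_classical all_reals all_analysis.
From mathcomp Require Import ess_sup_inf measurable_realfun.
From mathcomp Require Import zify ring lra.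

(* Start from quantiles 0 = y_0 <= ... <= y_n = 1 of order i/n. The power sums
   of y_0, ..., y_(n-1) differ from n times the moments of sigma by at most 1.
   Split most of these nodes into r of order n/k groups of k nodes, those of a
   group being separated by sigma-mass of order 1/k, and let every group absorb
   1/r of the error. For one group with nodes a_i this asks for numbers z_i
   whose first k power sums are those of the a_i, perturbed by at most 1/r. By
   Newton's identities the monic polynomial Q with roots z_i is determined by
   its power sums, and it is within k 2^k / r of P = prod (X - a_i) on [0,1].
   At the k+1 points that interlace the a_i, P has alternating signs and, since
   mass separation forces distance, |P| exceeds this bound as soon as n is
   large enough; so Q has k real roots in [0,1]. *)

Import Order.TTheory GRing.Theory Num.Theory.
Import numFieldNormedType.Exports.

Set Implicit Arguments.
Unset Strict Implicit.
Unset Printing Implicit Defensive.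

Local Open Scope classical_set_scope.
Local Open Scope charge_scope.
Local Open Scope ring_scope.

(** * Power sums as logarithmic derivatives *)

Section NewtonIdentities.
Variable F : fieldType.
Implicit Types (p q S T : {poly F}) (s : seq F).

(** Divisibility by ['X^N] plays the role of congruence modulo X^N, so that power series identities
    can be stated for polynomials. *)
Lemma dvdp_XnP N p :
  reflect (forall m, (m < N)%N -> p`_m = 0) ('X^N %| p).
Proof.
apply: (iffP idP) => [/dvdpP[q ->] m mN|p0]; first by rewrite coefMXn mN.
rewrite -(poly_take_drop N p) (_ : take_poly N p = 0) ?add0r ?dvdp_mull//.
by apply/polyP => m; rewrite coef_take_poly coef0; case: ifP => // /p0.
Qed.

(* That is, S is the power series -p'/p up to order N; for p = \prod (1 - c X)
   its coefficients are the power sums of the numbers c. *)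
Definition log_deriv N p S := 'X^N %| p^`() + S * p.

Lemma log_derivM N p q S T :
  log_deriv N p S -> log_deriv N q T -> log_deriv N (p * q) (S + T).
Proof.
rewrite /log_deriv derivM => pS qT.
have -> : p^`() * q + p * q^`() + (S + T) * (p * q) =
  (p^`() + S * p) * q + p * (q^`() + T * q) by ring.
by apply: dvdp_add; [apply: dvdp_mulr | apply: dvdp_mull].
Qed.

(** The geometric series c / (1 - c X), truncated. *)
Lemma log_deriv_lin N c :
  log_deriv N (1 - c *: 'X) (\poly_(j < N) c ^+ j.+1).
Proof.
apply/dvdp_XnP => m mN; rewrite mulrBr mulr1 -scalerAr.
rewrite derivB derivC sub0r derivZ derivX.
rewrite !coefD !coefN !coefZ coef1 coefMX !coef_poly mN.
case: m mN => [|m] mN /=; first by rewrite mulr1 mulr0 expr1; ring.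
by rewrite (ltnW mN) exprS; ring.
Qed.

Lemma log_deriv_prod N s :
  log_deriv N (\prod_(c <- s) (1 - c *: 'X))
              (\poly_(j < N) \sum_(c <- s) c ^+ j.+1).
Proof.
elim: s => [|c s IHs].
  rewrite !big_nil /log_deriv derivC add0r mulr1.
  by apply/dvdp_XnP => m mN; rewrite coef_poly mN big_nil.
rewrite big_cons (_ : poly _ _ =
  \poly_(j < N) c ^+ j.+1 + \poly_(j < N) \sum_(c <- s) c ^+ j.+1).
  exact: log_derivM (log_deriv_lin _ _) IHs.
by apply/polyP => m; rewrite coefD !coef_poly big_cons; case: ifP; rewrite ?addr0.
Qed.

(** Modulo X^N the polynomial [p] is invertible, so it determines its logarithmic derivative.
    Differentiation loses one order, hence [N.+1]. For products of factors 1 - c X this recovers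
    power sums from coefficients. *)
Lemma log_deriv_unique {N p q S T} :
  p`_0 != 0 -> 'X^(N.+1) %| p - q -> log_deriv N p S -> log_deriv N q T ->
  'X^N %| S - T.
Proof.
move=> p0 /dvdp_XnP pq pS qT.
have : 'X^N %| (S - T) * p.
  have -> : (S - T) * p =
      (p^`() + S * p) - (q^`() + T * q) - (p - q)^`() - T * (p - q).
    by rewrite derivB; ring.
  rewrite !dvdp_sub//; last first.
    by apply/dvdp_mull/dvdp_XnP => m mN; rewrite pq// ltnW.
  by apply/dvdp_XnP => m mN; rewrite coef_deriv pq// mul0rn.
by rewrite Gauss_dvdpl// coprimep_expl// coprimep_sym coprimepX rootE horner_coef0.
Qed.

(** Reversal X^d P(1/X), with d = [size s], turns each factor X - c of P into 1 - c X. *)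
Lemma coef_prod_1subX s m : (m <= size s)%N ->
  (\prod_(c <- s) (1 - c *: 'X))`_m = (\prod_(c <- s) ('X - c%:P))`_(size s - m).
Proof.
elim: s m => [|c s IHs] m.
  by rewrite leqn0 => /eqP ->; rewrite !big_nil.
rewrite !big_cons /= => ms.
have sP : size (\prod_(d <- s) ('X - d%:P)) = (size s).+1.
  exact: size_prod_XsubC.
have sE (r : seq F) : (size (\prod_(d <- r) (1 - d *: 'X))%R <= (size r).+1)%N.
  elim: r => [|d r IHr]; first by rewrite big_nil size_poly1.
  rewrite big_cons mulrBl mul1r -scalerAl (leq_trans (size_polyD _ _))//.
  rewrite geq_max (leq_trans IHr)//= size_polyN (leq_trans (size_scale_leq _ _))//.
  rewrite mulrC (leq_trans (size_polyMleq _ _))// size_polyX addn2 /=.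
  by rewrite ltnS.
rewrite !mulrBl mul1r !coefB -scalerAl coefZ coefXM coefXM mul_polyC coefZ.
case: m ms => [|m] ms.
  rewrite mulr0 subr0 !subn0 /= IHs// subn0.
  by rewrite (nth_default 0 (_ : size _ <= (size s).+1)%N) ?sP// mulr0 subr0.
rewrite subSS subn_eq0 /= (IHs m ms); congr (_ - _).
move: ms; rewrite ltnS leq_eqVlt => /predU1P[->|ms].
  by rewrite leqnn (nth_default _ (sE s)).
by rewrite leqNgt ms /= IHs// subnS.
Qed.

End NewtonIdentities.

(** * Perturbing the power sums of numbers in [0,1] *)

Section PerturbedPowerSums.
Variable R : rcfType.
Implicit Types (p q S T : {poly R}) (s : seq R).

(* G is the truncation of the power series exp(- \int T). *)
Lemma log_deriv_exists N T (eps : R) : 0 <= eps <= 1 ->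
  (forall j, `|T`_j| <= eps) ->
  exists G : {poly R}, [/\ (size G <= N.+1)%N, G`_0 = 1, log_deriv N G T &
                forall m, (0 < m)%N -> `|G`_m| <= eps].
Proof.
move=> /andP[eps0 eps1] Teps; elim: N => [|N [G [sG G0 GT Geps]]].
  exists 1; rewrite size_poly1 coef1 /log_deriv expr0 dvd1p; split=> // m m0.
  by rewrite coef1 eqn0Ngt m0 normr0.
(* G' = - T G forces the next coefficient to be - c / (N+1). As [c] is a sum of N+1 terms of
   absolute value at most [eps], the division restores the bound [eps]. *)
pose c := (T * G)`_N.
have c_le : `|c| <= eps * N.+1%:R.
  rewrite /c coefM (le_trans (ler_norm_sum _ _ _))// mulr_natr.
  rewrite -[X in _ *+ X](card_ord N.+1) -sumr_const.
  apply: ler_sum => i _; rewrite normrM.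
  have G1 : `|G`_(N - i)| <= 1.
    by case: (N - i)%N => [|m]; rewrite ?G0 ?normr1// (le_trans (Geps _ _)).
  by rewrite -[leRHS]mulr1 ler_pM.
exists (G - (c / N.+1%:R) *: 'X^(N.+1)); split.
- rewrite (leq_trans (size_polyD _ _))// geq_max (leq_trans sG)//=.
  by rewrite size_polyN (leq_trans (size_scale_leq _ _))// size_polyXn.
- by rewrite coefB coefZ coefXn mulr0 subr0.
- apply/dvdp_XnP => m; rewrite ltnS => mN.
  rewrite coefD coef_deriv mulrBr -scalerAr !coefB !coefZ coefMXn coefXn.
  rewrite ltnS mN mulr0 subr0.
  move: mN; rewrite leq_eqVlt => /predU1P[->|mN].
    rewrite eqxx mulr1 nth_default// sub0r mulNrn -[_ *+ _]mulr_natr divfK ?pnatr_eq0//.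
    by rewrite -/c addNr.
  move/dvdp_XnP/(_ m mN): GT; rewrite coefD coef_deriv.
  by rewrite eqSS (ltn_eqF mN) mulr0 subr0.
- move=> m m0; rewrite coefB coefZ coefXn; case: eqP => [->|_]; last first.
    by rewrite mulr0 subr0 Geps.
  rewrite nth_default// sub0r mulr1 normrN normrM normfV normr_nat.
  by rewrite ler_pdivrMr.
Qed.

(** The sum of the absolute values of the coefficients is submultiplicative and at most 2 for each
    factor 1 - c X. *)
Lemma sum_norm_coef_prod_1subX s M : {in s, forall c, 0 <= c <= 1} ->
  \sum_(m < M) `|(\prod_(c <- s) (1 - c *: 'X))`_m| <= 2 ^+ size s.
Proof.
elim: s M => [|c s IHs] M s01.
  rewrite big_nil expr0; case: M => [|M]; first by rewrite big_ord0.
  rewrite big_ord_recl coef1 normr1 big1 ?addr0// => i _.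
  by rewrite coef1 normr0.
have {}IHs N : \sum_(m < N) `|(\prod_(c <- s) (1 - c *: 'X))`_m| <= 2 ^+ size s.
  by apply: IHs => d ds; apply: s01; rewrite in_cons ds orbT.
have /andP[c0 c1] := s01 c (mem_head _ _).
rewrite big_cons; set E := \prod_(c <- s) _ in IHs *.
rewrite [size _]/= exprS mulr_natl mulr2n.
apply: (@le_trans _ _ (\sum_(m < M) (`|E`_m| + `|('X * E)`_m|))).
  apply: ler_sum => m _; rewrite mulrBl mul1r -scalerAl coefB coefZ.
  rewrite (le_trans (ler_normB _ _))// lerD2l normrM (ger0_norm c0).
  by rewrite -[leRHS]mul1r ler_wpM2r.
rewrite big_split lerD/= ?IHs//; case: M => [|M]; first by rewrite big_ord0 exprn_ge0.
rewrite big_ord_recl coefXM normr0 add0r.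
by under eq_bigr do rewrite coefXM /=.
Qed.

(** The k sign changes give k distinct roots by the intermediate value theorem, and a polynomial of
    degree k has no others. *)
Lemma alternating_roots p k (w : nat -> R) :
  p \is monic -> size p = k.+1 ->
  (forall l, (l < k)%N -> w l <= w l.+1) ->
  (forall l, (l <= k)%N -> 0 < (-1) ^+ (k - l) * p.[w l]) ->
  exists z : seq R, [/\ size z = k, {in z, forall c, w 0%N <= c <= w k} &
    p = \prod_(c <- z) ('X - c%:P)].
Proof.
move=> monp sp wle wsg.
have root_in l : exists c, (l < k)%N -> [/\ w l < c, c < w l.+1 & root p c].
  case: (ltnP l k) => lk; last by exists 0.
  have w1 := wsg _ (ltnW lk); have w2 := wsg _ lk.
  (* The scalar makes the polynomial negative at [w l] and positive at [w l.+1]. *)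
  have /(poly_ivt (wle _ lk))[c /andP[wc cw]] :
      (- (-1) ^+ (k - l) *: p).[w l] <= 0 <= (- (-1) ^+ (k - l) *: p).[w l.+1].
    rewrite !hornerZ; move: w1 w2; rewrite -(subnSK lk) exprS mulN1r.
    set t := (-1) ^+ _; rewrite !mulNr !opprK oppr_gt0 => *.
    by apply/andP; split; apply: ltW.
  rewrite rootZ ?oppr_eq0 ?signr_eq0// => rc; exists c => _.
  (* Roots avoid the points [w], so each lies strictly between two of them and all are distinct. *)
  have neq j : (j <= k)%N -> w j != c.
    move=> jk; apply: contraTneq (wsg _ jk) => ->.
    by rewrite (rootP rc) mulr0 ltxx.
  by split; rewrite // lt_neqAle ?neq// 1?ltnW// eq_sym neq.
have [z zP] := choice root_in.
have wle' i j : (i <= j)%N -> (j <= k)%N -> w i <= w j.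
  elim: j => [|j IHj]; first by rewrite leqn0 => /eqP ->.
  rewrite leq_eqVlt => /predU1P[->//|ij] jk.
  by rewrite (le_trans (IHj ij (ltnW jk)))// wle.
have zsort : sorted <%R (mkseq z k).
  apply/(sortedP 0) => i; rewrite size_mkseq => ik.
  rewrite !nth_mkseq ?(ltnW ik)//.
  have [_ z1 _] := zP _ (ltnW ik); have [z2 _ _] := zP _ ik.
  exact: lt_trans z2.
exists (mkseq z k); split.
- by rewrite size_mkseq.
- move=> c /mapP[i]; rewrite mem_iota add0n => /andP[_ ik] ->.
  have [z1 z2 _] := zP _ ik.
  by rewrite (le_trans (wle' 0%N i _ _) (ltW z1)) ?(ltnW ik)// (le_trans (ltW z2))// wle'.
- rewrite {1}(@all_roots_prod_XsubC _ p (mkseq z k)).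
  + by rewrite (monicP monp) scale1r.
  + by rewrite sp size_mkseq.
  + by apply/allP => c /mapP[i]; rewrite mem_iota add0n => /andP[_ /zP[]] ? ? ? ->.
  + by rewrite uniq_rootsE lt_sorted_uniq.
Qed.

End PerturbedPowerSums.

(** Logarithmic derivatives add, so adding [e] to the power sums multiplies the reversed polynomial
    by some G with constant term 1 and other coefficients at most [eps] in absolute value. On [0,1]
    this changes P by at most k eps 2^k, too little to alter its signs at the points [w]. *)
Lemma perturb_power_sums (R : rcfType) (k : nat) (a : seq R) (w e : nat -> R)
    (eps : R) :
  size a = k -> {in a, forall c, 0 <= c <= 1} ->
  0 <= eps <= 1 -> (forall j, (0 < j <= k)%N -> `|e j| <= eps) ->
  (forall l, (l <= k)%N -> 0 <= w l <= 1) ->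
  (forall l, (l < k)%N -> w l <= w l.+1) ->
  (forall l, (l <= k)%N -> k%:R * (eps * 2 ^+ k) <
     (-1) ^+ (k - l) * (\prod_(c <- a) ('X - c%:P)).[w l]) ->
  exists z : seq R, [/\ size z = k, {in z, forall c, 0 <= c <= 1} &
    forall j, (0 < j <= k)%N ->
      \sum_(c <- z) c ^+ j = \sum_(c <- a) c ^+ j + e j].
Proof.
move=> sa a01 eps01 eeps w01 wle; set P := \prod_(c <- a) _ => wP.
pose T := \poly_(j < k) e j.+1.
have /andP[eps0 eps1] := eps01.
have Teps j : `|T`_j| <= eps.
  by rewrite coef_poly; case: ifP => jk; rewrite ?normr0// eeps.
have [G [_ G0 GT Geps]] := log_deriv_exists k eps01 Teps.
(* E is the reversal of P, and Q that of E * G truncated at degree k. *)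
pose E := \prod_(c <- a) (1 - c *: 'X).
pose Q := \poly_(i < k.+1) (E * G)`_(k - i).
have PE i : (i <= k)%N -> P`_i = E`_(k - i).
  by move=> ik; rewrite coef_prod_1subX sa ?leq_subr// subKn.
have sP : size P = k.+1 by rewrite size_prod_XsubC sa.
have P1 : P \is monic by rewrite monic_prod_XsubC.
have E0 : E`_0 = 1.
  by rewrite -[0%N](subnn k) -PE// -[k]/(k.+1.-1) -sP -lead_coefE (monicP P1).
have EG0 : (E * G)`_0 = 1 by rewrite coefM big_ord1 E0 G0 mulr1.
have sQ : size Q = k.+1 by rewrite size_poly_eq// subnn EG0 oner_neq0.
have Q1 : Q \is monic by rewrite monicE lead_coefE sQ /= coef_poly ltnSn subnn EG0.
(* The leading terms cancel. This leaves k coefficients of E (G - 1), each at most [eps] times the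
   absolute coefficient sum of E. *)
have diff x : 0 <= x <= 1 -> `|Q.[x] - P.[x]| <= k%:R * (eps * 2 ^+ k).
  move=> /andP[x0 x1].
  have -> : Q.[x] - P.[x] = \sum_(i < k) (E * (G - 1))`_(k - i) * x ^+ i.
    rewrite horner_poly (horner_coef_wide _ (eq_leq sP)) -sumrB big_ord_recr /=.
    rewrite PE// subnn EG0 E0 subrr addr0; apply: eq_bigr => i _.
    by rewrite PE ?(ltnW (ltn_ord i))// -mulrBl mulrBr mulr1 coefB.
  rewrite (le_trans (ler_norm_sum _ _ _))// mulr_natl.
  rewrite -[X in _ *+ X](card_ord k) -sumr_const; apply: ler_sum => i _.
  have xi : `|x ^+ i| <= 1 by rewrite ger0_norm ?exprn_ge0// exprn_ile1.
  rewrite normrM -[leRHS]mulr1 ler_pM//.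
  have := sum_norm_coef_prod_1subX (k - i).+1 a01; rewrite -/E sa => /(ler_wpM2l eps0).
  apply: le_trans; rewrite coefM (le_trans (ler_norm_sum _ _ _))// mulr_sumr.
  apply: ler_sum => l _; rewrite normrM mulrC ler_wpM2r// coefB coef1.
  by case: (_ - _)%N => [|m]; rewrite ?G0 ?subrr ?normr0// subr0 Geps.
have [|z [sz z01 Qz]] := alternating_roots Q1 sQ wle.
  move=> l lk; have := wP l lk; have := diff _ (w01 l lk).
  rewrite -(normrMsign (k - l)) mulrBr => d1 d2.
  have := le_lt_trans d1 d2; rewrite ltr_norml => /andP[+ _].
  by rewrite ltrBrDl subrr.
exists z; split=> //.
  move=> c /z01; have /andP[w0 _] := w01 0%N isT; have /andP[_ wk] := w01 k (leqnn k).
  by move=> /andP[c1 c2]; rewrite (le_trans w0)//= (le_trans c2).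
pose Ez := \prod_(c <- z) (1 - c *: 'X).
have EzE m : (m <= k)%N -> Ez`_m = (E * G)`_m.
  move=> mk; rewrite /Ez coef_prod_1subX ?sz// -Qz coef_poly ltnS leq_subr.
  by rewrite subKn.
(* The reversal of Q agrees with E G up to degree k, so their logarithmic derivatives agree up to
   order k, which are the power sums of exponents 1 to k. *)
have /log_deriv_unique uni : Ez`_0 != 0 by rewrite EzE// EG0 oner_neq0.
have /uni {}uni : 'X^(k.+1) %| Ez - E * G.
  by apply/dvdp_XnP => m mk; rewrite coefB EzE ?subrr.
have /dvdp_XnP {}uni := uni _ _ (log_deriv_prod k z)
  (log_derivM (log_deriv_prod k a) GT).
move=> [//|j] /= jk; have := uni j jk.
by rewrite coefB coefD !coef_poly jk => /subr0_eq.
Qed.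

(** * Groups of interlaced nodes *)

(** The factors below [w] contribute at least l! g^l and those above at least (k-l)! g^(k-l). The
    factor 2^k bounds the binomial coefficient k! / (l! (k-l)!). *)
Lemma prod_separated_ge (R : realFieldType) (k l : nat) (g w : R)
    (a : nat -> R) : (l <= k)%N -> 0 <= g ->
  (forall i, (i < l)%N -> (l - i)%:R * g <= w - a i) ->
  (forall i, (l <= i < k)%N -> (i - l).+1%:R * g <= a i - w) ->
  k`!%:R * g ^+ k <= 2 ^+ k * ((-1) ^+ (k - l) * \prod_(i < k) (w - a i)).
Proof.
move=> lk g0 wa aw.
have low : l`!%:R * g ^+ l <= \prod_(0 <= i < l) (w - a i).
  have -> : l`!%:R * g ^+ l = \prod_(0 <= i < l) ((l - i)%:R * g).
    rewrite big_split prodr_const_nat subn0 fact_prod natr_prod /=; congr (_ * _).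
    rewrite big_add1 /= [RHS]big_nat_rev; apply: eq_big_nat => i /andP[_ il].
    by rewrite add0n subKn.
  rewrite big_nat [leRHS]big_nat; apply: ler_prod => i /andP[_ il].
  by rewrite mulr_ge0//= wa.
have high : (k - l)`!%:R * g ^+ (k - l) <=
    (-1) ^+ (k - l) * \prod_(l <= i < k) (w - a i).
  rewrite -!prodr_const_nat -[leRHS]big_split /=.
  have -> : (k - l)`!%:R * \prod_(l <= i < k) g =
      \prod_(l <= i < k) ((i - l).+1%:R * g).
    rewrite big_split fact_prod natr_prod /=; congr (_ * _).
    rewrite big_add1 /= -[RHS]/(\prod_(0 + l <= i < k) (i - l).+1%:R) big_addn.
    by apply: eq_big_nat => i _; rewrite addnK.
  rewrite big_nat [leRHS]big_nat; apply: ler_prod => i ilk.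
  by rewrite mulr_ge0//= mulN1r opprB aw.
rewrite -(bin_fact lk) natrM -mulrA ler_pM ?mulr_ge0 ?exprn_ge0 ?ler0n//.
  rewrite -natrX ler_nat -[2%N]/(1 + 1)%N expnDn (bigD1 (inord l)) //=.
  by rewrite !exp1n !muln1 inordK ?ltnS// leq_addr.
have -> : g ^+ k = g ^+ l * g ^+ (k - l) by rewrite -exprD subnKC.
rewrite natrM mulrACA.
rewrite -(big_mkord xpredT (fun i => w - a i)) (@big_cat_nat _ _ _ l)//= [leRHS]mulrCA.
by rewrite ler_pM ?mulr_ge0 ?exprn_ge0 ?ler0n.
Qed.

(** Writing i = s + d q sorts the indices by residue; each residue class will be one group of
    nodes. *)
Lemma sum_nat_divmod (V : nmodType) (d k : nat) (F : nat -> V) :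
  \sum_(0 <= i < k * d) F i = \sum_(s < d) \sum_(q < k) F (s + d * q)%N.
Proof.
elim: k => [|k IHk].
  by rewrite mul0n big_nil big1// => s _; rewrite big_ord0.
rewrite mulSn addnC (@big_cat_nat _ _ _ (k * d)) ?leq_addr//= IHk.
under [RHS]eq_bigr do rewrite big_ord_recr /=.
rewrite big_split /=; congr (_ + _).
rewrite -{1}[(k * d)%N]add0n big_addn addnC addnK big_mkord.
by apply: eq_bigr => i _; rewrite (mulnC k).
Qed.

(* The s-th group, s < 2h, consists of the nodes y_(s + h + 2hq), q < k; it is
   interlaced by the points y_(s + 2hl), l <= k. *)
Lemma nodes_with_perturbed_power_sums (R : rcfType) (k n h : nat) (g : R)
    (y d : nat -> R) :
  (0 < h)%N -> (2 * h * k.+1 <= n)%N -> 0 <= g ->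
  (forall i, (i < n)%N -> 0 <= y i <= 1) ->
  (forall i j a, (a <= k)%N -> (i + a * h <= j)%N -> (j < n)%N ->
     a%:R * g <= y j - y i) ->
  (forall j, (0 < j <= k)%N -> `|d j| <= 1) ->
  k%:R * 4 ^+ k < (2 * h)%:R * (k`!%:R * g ^+ k) ->
  exists x : 'I_n -> R, (forall i, 0 <= x i <= 1) /\
    forall j, (0 < j <= k)%N ->
      \sum_(i < n) x i ^+ j = \sum_(i < n) y i ^+ j + d j.
Proof.
move=> h0 hn g0 y01 gap d1 hk.
pose D := (2 * h)%N; have D0 : (0 < D)%N by rewrite /D; lia.
have DR0 : 0 < D%:R :> R by rewrite ltr0n.
have idx s q : (s < D)%N -> (q <= k)%N -> (s + D * q < n)%N.
  by move=> sD qk; apply: leq_trans hn; rewrite -/D; nia.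
have idx2 s q : (s < D)%N -> (q < k)%N -> (h + (s + D * q) < n)%N.
  by move=> sD qk; apply: leq_trans hn; rewrite /D in sD *; nia.
have group (s : nat) : exists z : seq R, (s < D)%N ->
    [/\ size z = k, {in z, forall c, 0 <= c <= 1} &
      forall j, (0 < j <= k)%N -> \sum_(c <- z) c ^+ j =
        \sum_(q < k) y (h + (s + D * q))%N ^+ j + d j / D%:R].
  (* No group has an index s >= D; the empty list is a default value that lets [choice] apply. *)
  case: (ltnP s D) => sD; last by exists [::].
  pose a := mkseq (fun q => y (h + (s + D * q))%N) k.
  have suma j : \sum_(c <- a) c ^+ j = \sum_(q < k) y (h + (s + D * q))%N ^+ j.
    by rewrite big_map -{1}[k]subn0 big_mkord.
  have hora t : (\prod_(c <- a) ('X - c%:P)).[t] =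
      \prod_(q < k) (t - y (h + (s + D * q))%N).
    rewrite horner_prod big_map -{1}[k]subn0 big_mkord.
    by apply: eq_bigr => q _; rewrite hornerXsubC.
  (* Each of the [D] groups takes the share 1/D of the error. *)
  have [| | | | | | |z [sz z01 zj]] := @perturb_power_sums R k a
    (fun l => y (s + D * l)%N) (fun j => d j / D%:R) D%:R^-1.
  - by rewrite size_mkseq.
  - move=> c /mapP[q]; rewrite mem_iota => /andP[_ qk] ->.
    by apply: y01; apply: idx2.
  - by rewrite invr_ge0 ler0n/= invf_le1// ler1n.
  - by move=> j jk; rewrite normrM normfV normr_nat ler_piMl ?invr_ge0 ?d1.
  - by move=> l lk; apply: y01; apply: idx.
  (* At a = 0 the gap hypothesis says that [y] is nondecreasing. *)
  - move=> l lk; rewrite -subr_ge0; apply: (le_trans (mulr_ge0 (ler0n _ 0) g0)).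
    by apply: gap; [lia | nia | exact: idx].
  - move=> l lk; rewrite hora.
    rewrite -(ltr_pM2l (_ : 0 < 2 ^+ k)) ?exprn_gt0//.
    apply: (lt_le_trans _ (@prod_separated_ge _ _ _ g _
      (fun q => y (h + (s + D * q))%N) lk g0 _ _)).
    (* One factor 2^k of 4^k comes from the perturbation, the other from the lower bound on the
       product. *)
    + rewrite -(ltr_pM2l DR0); apply: le_lt_trans hk.
      rewrite -[4]/(2 * 2)%:R natrM exprMn; rewrite le_eqVlt; apply/orP; left; apply/eqP.
      by field; rewrite gt_eqF.
    (* The index distance is (2(l-i) - 1) h >= (l-i) h below the point, and (2(i-l) + 1) h >=
       (i-l+1) h above it. *)
    + move=> i il; apply: gap; first by lia.
      * by rewrite /D; nia.
      * exact: idx.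
    + move=> i /andP[li ik]; apply: gap; first by lia.
      * by rewrite /D; nia.
      * exact: idx2.
  exists z => _; split=> // j jk; by rewrite zj// suma.
have {group} [z zP] := choice group.
(* The node of index h + s + D q is replaced by entry q of the list of group s; nodes outside the
   window stay. *)
pose x i := if (h <= i < h + k * D)%N then nth 0 (z ((i - h) %% D)%N) ((i - h) %/ D)
            else y i.
exists x; split.
  move=> i; rewrite /x; case: ifP => [/andP[hi ih]|_]; last exact: y01.
  have [sz z01 _] := zP _ (ltn_pmod (i - h) D0).
  by apply: z01; rewrite mem_nth// sz ltn_divLR//; lia.
move=> j jk; apply/eqP; rewrite [eqbRHS]addrC -subr_eq; apply/eqP.
have hkn : (h + k * D <= n)%N by rewrite /D; lia.
transitivity (\sum_(s < D) d j / D%:R).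
  have out i : ~~ (h <= i < h + k * D)%N -> x i ^+ j - y i ^+ j = 0.
    by rewrite /x => /negbTE ->; rewrite subrr.
  rewrite -sumrB -(big_mkord xpredT (fun i => x i ^+ j - y i ^+ j)).
  rewrite (@big_cat_nat _ _ _ (h + k * D)%N)//= [X in _ + X]big_nat.
  rewrite [X in _ + X]big1 ?addr0; last first.
    by move=> i /andP[hi _]; apply: out; rewrite [(i < _)%N]ltnNge hi andbF.
  rewrite (@big_cat_nat _ _ _ h) ?leq_addr//= big_nat big1 ?add0r; last first.
    by move=> i /andP[_ hi]; apply: out; rewrite [(h <= i)%N]leqNgt hi.
  rewrite -{1}[h]add0n big_addn addKn sum_nat_divmod.
  apply: eq_bigr => s _; have [sz _ zj] := zP s (ltn_ord s).
  rewrite sumrB; apply/eqP; rewrite subr_eq addrC; apply/eqP.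
  under [X in _ = X + _]eq_bigr do rewrite addnC.
  rewrite -zj// (big_nth 0) sz big_mkord; apply: eq_bigr => q _.
  rewrite /x ifT; last by have := ltn_ord q; have := ltn_ord s; nia.
  rewrite addnK [(s + _)%N]addnC [(D * _)%N]mulnC divnMDl// modnMDl.
  by rewrite divn_small// modn_small// addn0.
by rewrite sumr_const card_ord -[LHS]mulr_natr divfK ?gt_eqF.
Qed.

(** * Quantiles and moments *)

Section MeasureOnUnitInterval.
Variable R : realType.
Variable sigma : probability (measurableTypeR R) R.

Lemma le_measure_itv (i j : interval R) :
  ([set` i] `<=` [set` j] -> sigma [set` i] <= sigma [set` j])%E.
Proof. by move=> ij; apply: le_measure; rewrite ?inE//; exact: measurable_itv. Qed.

(** The measure is the integral of its Radon-Nikodym derivative, which is at most M off a null set;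
    that set is cut out of [x,y] before the integrals are compared. *)
Lemma bounded_density_le (M : R) :
  sigma `<< (@lebesgue_measure R) ->
  (ess_sup (@lebesgue_measure R)
     ('d (charge_of_finite_measure sigma) '/d (@lebesgue_measure R))
   <= M%:E)%E ->
  forall x y : R, x <= y -> (sigma `[x, y]%classic <= (M * (y - x))%:E)%E.
Proof.
move=> ac /ess_supP [N [mN N0 fN]] x y xy.
pose f := 'd (charge_of_finite_measure sigma) '/d (@lebesgue_measure R).
have mI : measurable (`[x, y]%classic : set (measurableTypeR R)).
  exact: measurable_itv.
have -> : sigma `[x, y]%classic = (\int[lebesgue_measure]_(t in `[x, y]) f t)%E.
  by rewrite -(Radon_Nikodym_integral (nu := charge_of_finite_measure sigma)).
have intf : lebesgue_measure.-integrable `[x, y] f.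
  apply: (integrableS measurableT) => //.
  exact: (Radon_Nikodym_integrable (nu := charge_of_finite_measure sigma)).
have fin : (lebesgue_measure (`[x, y]%classic : set R) < +oo)%E.
  by rewrite lebesgue_measure_itv /=; case: ifP => _; rewrite ?ltry// -EFinB ltry.
have intM : lebesgue_measure.-integrable `[x, y] (EFin \o cst M).
  by apply: measurable_bounded_integrable => //; exact: bounded_cst.
rewrite (negligible_integral mN mI intf N0).
apply: (@le_trans _ _ (\int[lebesgue_measure]_(t in `[x, y] `\` N) M%:E)%E).
  apply: le_integral.
  - exact: measurableD.
  - apply: integrableS intf => //; exact: measurableD.
  - apply: integrableS intM => //; exact: measurableD.
  - move=> t; rewrite inE => -[_ Nt]; apply: contrapT => ft; apply: Nt.
    by apply: fN => /=.
rewrite -(negligible_integral mN mI intM N0) (integral_cst _ mI M%:E).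
rewrite [X in (_ * X)%E](_ : _ = lebesgue_measure (`[x, y]%classic : set R))//.
rewrite lebesgue_measure_itv /=.
rewrite lte_fin; case: ltP => [_|yx]; first by rewrite -EFinB -EFinM.
by rewrite mule0 lee_fin (_ : y = x) ?subrr ?mulr0//; apply/le_anti/andP.
Qed.

Hypothesis sigma01 : sigma `[0, 1]%classic = 1%E.

Lemma sigma_setC01 : sigma (~` `[0, 1]) = 0%E.
Proof.
rewrite probability_setC; first by rewrite sigma01 subee.
exact: measurable_itv.
Qed.

Lemma sigma_ltNy (t : R) : t <= 0 -> sigma `]-oo, t[%classic = 0%E.
Proof.
move=> t0; apply/eqP; rewrite -measure_le0 -sigma_setC01.
apply: le_measure; rewrite ?inE//; first exact: measurableC.
move=> x /=; rewrite !in_itv /= => xt /andP[x0 _].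
by have := lt_le_trans xt (le_trans t0 x0); rewrite ltxx.
Qed.

Lemma sigma_Nyc1 : sigma `]-oo, 1]%classic = 1%E.
Proof.
apply/eqP; rewrite eq_le probability_le1//= -sigma01.
by apply: le_measure_itv; apply: subset_itvr.
Qed.

Lemma quantile_exists (u : R) : 0 <= u <= 1 ->
  exists t, 0 <= t <= 1 /\ (sigma `]-oo, t[%classic <= u%:E <= sigma `]-oo, t]%classic)%E.
Proof.
move=> /andP[u0 u1].
pose S := [set t : R | 0 <= t /\ (u%:E <= sigma `]-oo, t]%classic)%E].
have S1 : S 1 by split => //; rewrite sigma_Nyc1 lee_fin.
have S0 : lbound S 0 by move=> t [].
have infS0 : 0 <= inf S by apply: lb_le_inf => //; exists 1.
exists (inf S); split.
  by rewrite infS0 /=; apply: ge_inf => //; exists 0.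
apply/andP; split.
  pose F m := `]-oo, (inf S - m.+1%:R^-1)]%classic : set (measurableTypeR R).
  have FE : `]-oo, inf S[%classic = \bigcup_m F m.
    apply/seteqP; split=> [x|x [m _]]; rewrite /F /= !in_itv /=.
      by move=> /ltr_add_invr[m xm]; exists m => //=; rewrite in_itv /= lerBrDr ltW.
    by move=> /le_lt_trans; apply; rewrite ltrBlDr ltrDl invr_gt0.
  have : (sigma \o F) m @[m --> \oo] --> sigma (\bigcup_m F m).
    apply: nondecreasing_cvg_mu => //.
    - by move=> m; exact: measurable_itv.
    - by apply: bigcupT_measurable => m; exact: measurable_itv.
    - move=> m n mn; apply/subsetPset; apply: subset_itvl; rewrite bnd_simp.
      by rewrite lerD2l lerN2 lef_pV2 ?posrE// ler_nat.
  rewrite FE => cvF; apply: (cvge_le _ cvF); apply: nearW => m /=.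
  have lt_inf : inf S - m.+1%:R^-1 < inf S by rewrite ltrBlDr ltrDl invr_gt0.
  (* A negative point is outside [S] whatever its half-line weighs; that half-line is null. *)
  have [t0|t0] := ltP (inf S - m.+1%:R^-1) 0.
    apply: (@le_trans _ _ (sigma `]-oo, 0[%classic)); last first.
      by rewrite sigma_ltNy// lee_fin.
    by apply: le_measure_itv; apply: subset_itvl; rewrite bnd_simp.
  rewrite leNgt; apply/negP => /ltW uF.
  have : inf S <= inf S - m.+1%:R^-1 by apply: ge_inf; [exists 0|split].
  by rewrite leNgt lt_inf.
pose F m := `]-oo, (inf S + m.+1%:R^-1)]%classic : set (measurableTypeR R).
have : (sigma \o F) m @[m --> \oo] --> sigma (\bigcap_m F m).
  apply: nonincreasing_cvg_mu => //.
  - by rewrite (le_lt_trans (probability_le1 _ _)) ?ltry//; exact: measurable_itv.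
  - by move=> m; exact: measurable_itv.
  - by apply: bigcapT_measurable => m; exact: measurable_itv.
  - move=> m n mn; apply/subsetPset; apply: subset_itvl; rewrite bnd_simp.
    by rewrite lerD2l lef_pV2 ?posrE// ler_nat.
rewrite (itvNycEbigcap false) => cvF; apply: (cvge_ge _ cvF); apply: nearW => m /=.
have [||t [_ ut] tm] := @inf_adherent _ S m.+1%:R^-1; first by rewrite invr_gt0.
  by split; [exists 1|exists 0].
apply: (le_trans ut); apply: le_measure_itv.
by apply: subset_itvl; rewrite bnd_simp ltW.
Qed.


Lemma quantile_nodes (n : nat) : (0 < n)%N -> exists y : nat -> R,
  [/\ y 0%N = 0, y n = 1,
      forall i, (i <= n)%N -> 0 <= y i <= 1,
      forall i, (i < n)%N -> y i <= y i.+1 &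
      forall i, (i <= n)%N -> (sigma `]-oo, y i[%classic <= (i%:R / n%:R)%:E
                               <= sigma `]-oo, y i]%classic)%E].
Proof.
move=> n0; have nR0 : 0 < n%:R :> R by rewrite ltr0n.
have ex i : exists t, (i <= n)%N -> 0 <= t <= 1 /\
  (sigma `]-oo, t[%classic <= (i%:R / n%:R)%:E <= sigma `]-oo, t]%classic)%E.
  case: (leqP i n) => [i_n|_]; last by exists 0.
  have [|t tP] := @quantile_exists (i%:R / n%:R); last by exists t.
  by rewrite divr_ge0//= ler_pdivrMr// mul1r ler_nat.
have {ex} [q qP] := choice ex.
(* The end nodes are prescribed, so that the increments of t^j over the nodes sum to 1. *)
pose y i := if i == 0%N then 0 else if i == n then 1 else q i.
have y01 i : (i <= n)%N -> 0 <= y i <= 1.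
  rewrite /y => i_n; case: eqP => _; first by rewrite lexx ler01.
  by case: eqP => _; [rewrite lexx ler01 | case: (qP i i_n)].
have yq i : (i <= n)%N -> (sigma `]-oo, y i[%classic <= (i%:R / n%:R)%:E
                               <= sigma `]-oo, y i]%classic)%E.
  rewrite /y => i_n; case: eqP => [->|_].
    by rewrite mul0r sigma_ltNy// lexx /=; exact: measure_ge0.
  case: eqP => [->|_]; last by case: (qP i i_n).
  rewrite divff ?gt_eqF// sigma_Nyc1 lexx andbT.
  by apply: probability_le1; exact: measurable_itv.
exists y; split=> //; first by rewrite /y eqxx (gtn_eqF n0).
(* If y_(i+1) < y_i, the closed half-line at y_(i+1) lies in the open one at y_i, whence (i+1)/n <=
   i/n. *)
move=> i i_n; rewrite leNgt; apply/negP => yy.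
have /andP[_ q1] := yq _ i_n; have /andP[q2 _] := yq _ (ltnW i_n).
have : (i.+1%:R / n%:R <= i%:R / n%:R :> R).
  rewrite -lee_fin; apply: (le_trans q1); apply: le_trans q2.
  by apply: le_measure_itv; apply: subset_itvl; rewrite bnd_simp.
by rewrite ler_pM2r ?invr_gt0// ler_nat ltnn.
Qed.

(** * Comparison of moments with sums over quantiles *)

Lemma sigma_setI01 (A : set (measurableTypeR R)) : measurable A ->
  sigma (A `&` `[0, 1]) = sigma A.
Proof.
move=> mA; have mI : measurable (`[0, 1]%classic : set (measurableTypeR R)).
  exact: measurable_itv.
rewrite [RHS](measureDI sigma mA mI) [X in (X + _)%E](_ : _ = 0%E) ?add0e//.
apply/eqP; rewrite -measure_le0 -sigma_setC01.
apply: le_measure; rewrite ?inE; [exact: measurableD|exact: measurableC|].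
by move=> x [].
Qed.

Lemma integral_step (n : nat) (c : nat -> R)
    (A : nat -> set (measurableTypeR R)) :
  (forall i, measurable (A i)) -> (forall i, (i < n)%N -> 0 <= c i) ->
  (\int[sigma]_(t in `[0%R, 1%R]) (\sum_(i < n) c i * \1_(A i) t)%:E =
   \sum_(i < n) (c i)%:E * sigma (A i))%E.
Proof.
move=> mA c0.
have mI : measurable (`[0, 1]%classic : set (measurableTypeR R)).
  exact: measurable_itv.
under eq_integral do rewrite -sumEFin.
rewrite ge0_integral_sum//; last 2 first.
- by move=> i; apply/measurable_EFinP; apply: measurable_funM.
- by move=> i t _; rewrite lee_fin mulr_ge0 ?c0.
apply: eq_bigr => i _; under eq_integral do rewrite EFinM.
rewrite ge0_integralZl_EFin ?c0//; last first.
  by apply/measurable_EFinP; apply: measurable_indic; exact: mA.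
rewrite integral_indic; [|exact: mI|exact: mA].
by congr (_ * _)%E; exact: sigma_setI01.
Qed.

(** The sum telescopes to f at the last node not exceeding t. *)
Lemma sum_steps_le (f : R -> R) (y : nat -> R) (n : nat) (t : R) :
  {in `[0, 1] &, {homo f : a b / a <= b}} -> f 0 = 0 -> y 0%N = 0 ->
  (forall i, (i <= n)%N -> 0 <= y i <= 1) -> (forall i, (i < n)%N -> y i <= y i.+1) ->
  0 <= t <= 1 ->
  \sum_(i < n) (f (y i.+1) - f (y i)) * \1_(`[y i.+1, +oo[) t <= f t.
Proof.
move=> fle f0 y0 + + t01.
(* The second bound carries the induction when the new node is at most t. *)
suff : (forall i, (i <= n)%N -> 0 <= y i <= 1) ->
  (forall i, (i < n)%N -> y i <= y i.+1) ->
  \sum_(i < n) (f (y i.+1) - f (y i)) * \1_(`[y i.+1, +oo[) t <= f t /\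
  \sum_(i < n) (f (y i.+1) - f (y i)) * \1_(`[y i.+1, +oo[) t <= f (y n).
  by move=> H y01 yle; have [] := H y01 yle.
elim: n => [|n IHn] y01 yle.
  rewrite big_ord0 y0 f0 lexx; split=> //; rewrite -f0; have /andP[t0 _] := t01.
  by apply: fle => //; rewrite in_itv /= lexx ler01.
have [||S1 S2] := IHn; first by move=> i i_n; apply: y01; exact: leqW.
  by move=> i i_n; apply: yle; exact: leqW.
rewrite big_ord_recr /= indicE.
have fy : f (y n) <= f (y n.+1) by apply: fle; rewrite ?in_itv/= ?y01// yle.
have [yt|ty] := leP (y n.+1) t.
  rewrite mem_set /= ?in_itv/= ?yt// mulr1.
  have ft : f (y n.+1) <= f t by apply: fle; rewrite ?in_itv/= ?y01.
  by split; lra.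
rewrite memNset /= ?in_itv/= ?[y _ <= t]leNgt ?ty// mulr0 addr0; split => //.
exact: le_trans S2 fy.
Qed.

(** For t > 0 the sum telescopes to f at the first node not below t. *)
Lemma sum_steps_ge (f : R -> R) (y : nat -> R) (n : nat) (t : R) :
  {in `[0, 1] &, {homo f : a b / a <= b}} -> f 0 = 0 -> y 0%N = 0 -> y n = 1 ->
  (forall i, (i <= n)%N -> 0 <= y i <= 1) -> (forall i, (i < n)%N -> y i <= y i.+1) ->
  0 <= t <= 1 ->
  f t <= \sum_(i < n) (f (y i.+1) - f (y i)) * \1_(`]y i, +oo[) t.
Proof.
move=> fle f0 y0 yn + + t01.
(* The minimum gives a claim that also holds for initial segments of nodes, which need not reach
   1. *)
suff : (forall i, (i <= n)%N -> 0 <= y i <= 1) ->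
  (forall i, (i < n)%N -> y i <= y i.+1) ->
  f (Num.min t (y n)) <= \sum_(i < n) (f (y i.+1) - f (y i)) * \1_(`]y i, +oo[) t.
  by move=> H y01 yle; have := H y01 yle; rewrite yn min_l//; case/andP: t01.
elim: n {yn} => [|n IHn] y01 yle.
  by rewrite big_ord0 y0 min_r ?f0//; case/andP: t01.
have {}IHn := IHn (fun i i_n => y01 i (leqW i_n)) (fun i i_n => yle i (leqW i_n)).
rewrite big_ord_recr /= indicE.
have min01 i : (i <= n.+1)%N -> Num.min t (y i) \in `[0, 1].
  move=> /y01/andP[yi _]; case/andP: t01 => t0 t1.
  by rewrite in_itv /= le_min ge_min t0 t1 yi.
have [ty|yt] := leP t (y n).
  rewrite memNset /= ?in_itv/= ?andbT ?[y n < t]ltNge ?ty//= mulr0 addr0.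
  rewrite min_l ?(le_trans ty) ?yle//.
  by move: IHn; rewrite min_l.
rewrite mem_set /= ?in_itv/= ?yt// mulr1.
move: IHn; rewrite min_r ?(ltW yt)//.
have : f (Num.min t (y n.+1)) <= f (y n.+1).
  by apply: fle; rewrite ?min01 ?in_itv/= ?y01// ge_min lexx orbT.
lra.
Qed.

(** Summation by parts, which turns increments weighted by tail masses into a sum of node values. *)
Lemma sum_abel (F : nat -> R) (n : nat) :
  \sum_(i < n) (F i.+1 - F i) * (n - i)%:R = \sum_(i < n) F i.+1 - n%:R * F 0%N.
Proof.
elim: n => [|n IHn]; first by rewrite !big_ord0 mul0r subr0.
have -> : \sum_(i < n.+1) (F i.+1 - F i) * (n.+1 - i)%:R =
    \sum_(i < n.+1) (F i.+1 - F i) * (n - i)%:R + \sum_(i < n.+1) (F i.+1 - F i).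
  rewrite -big_split /=; apply: eq_bigr => i _.
  by rewrite subSn ?leq_ord// -natr1 mulrDr mulr1.
rewrite big_ord_recr /= IHn subnn mulr0 addr0 -(big_mkord xpredT (fun i => F i.+1 - F i)).
rewrite telescope_sumr// [in RHS]big_ord_recr /= -natr1; ring.
Qed.

(** Two step functions bracket t^j. Their integrals involve the tail masses beyond the nodes, which
    the quantile inequalities compare with multiples of 1/n. The resulting bounds on n times the
    moment differ by the total increment of t^j, that is 1. *)
Lemma moment_quantile (y : nat -> R) (n j : nat) : (0 < n)%N -> (0 < j)%N ->
  y 0%N = 0 -> y n = 1 ->
  (forall i, (i <= n)%N -> 0 <= y i <= 1) -> (forall i, (i < n)%N -> y i <= y i.+1) ->
  (forall i, (i <= n)%N -> (sigma `]-oo, y i[%classic <= (i%:R / n%:R)%:E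
                               <= sigma `]-oo, y i]%classic)%E) ->
  exists d : R, `|d| <= 1 /\
    (\int[sigma]_t (t ^+ j)%:E =
     (n%:R^-1 * (\sum_(i < n) y i ^+ j + d))%:E)%E.
Proof.
move=> n0 j0 y0 yn y01 yle yq; have nR0 : 0 < n%:R :> R by rewrite ltr0n.
have mI : measurable (`[0, 1]%classic : set (measurableTypeR R)).
  exact: measurable_itv.
have fle : {in `[0, 1] &, {homo (fun t : R => t ^+ j) : a b / a <= b}}.
  move=> a b; rewrite !in_itv /= => /andP[a0 _] _ ab.
  by rewrite lerXn2r ?nnegrE// (le_trans a0).
have f0 : (0 : R) ^+ j = 0 by rewrite expr0n (gtn_eqF j0).
have mf (D : set (measurableTypeR R)) : measurable_fun D (fun t : R => (t ^+ j)%:E).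
  by apply/measurable_EFinP; exact: exprn_measurable.
have -> : (\int[sigma]_t (t ^+ j)%:E = \int[sigma]_(t in `[0%R, 1%R]) (t ^+ j)%:E)%E.
  rewrite [RHS]integral_mkcond; apply: ae_eq_integral => //.
    by apply/(measurable_restrictT _ mI); exact: mf.
  exists (~` `[0, 1]); split; first exact: measurableC.
    exact: sigma_setC01.
  move=> t /=; apply: contra_not => tI _.
  by rewrite patchE mem_set.
have c0 i : (i < n)%N -> 0 <= y i.+1 ^+ j - y i ^+ j.
  by move=> i_n; rewrite subr_ge0 fle ?in_itv/= ?y01// ?yle// ltnW.
have telF : \sum_(i < n) (y i.+1 ^+ j - y i ^+ j) = 1.
  rewrite -(big_mkord xpredT (fun i => y i.+1 ^+ j - y i ^+ j)) telescope_sumr//.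
  by rewrite yn y0 f0 expr1n subr0.
(* The right-hand side is the integral that the upper step function would have if the tail beyond
   y_i had mass exactly 1 - i/n. *)
have sumD : n%:R^-1 * (\sum_(i < n) y i ^+ j + 1) =
    \sum_(i < n) (y i.+1 ^+ j - y i ^+ j) * (1 - i%:R / n%:R).
  have -> : \sum_(i < n) y i ^+ j + 1 = \sum_(i < n) y i.+1 ^+ j.
    by rewrite -telF -big_split; apply: eq_bigr => i _ /=; ring.
  have := sum_abel (fun i => y i ^+ j) n; rewrite y0 f0 mulr0 subr0 => <-.
  rewrite mulr_sumr; apply: eq_bigr => i _.
  by rewrite natrB ?(ltnW (ltn_ord i))//; field; rewrite gt_eqF.
have lo : ((n%:R^-1 * \sum_(i < n) y i ^+ j)%:E <=
           \int[sigma]_(t in `[0%R, 1%R]) (t ^+ j)%:E)%E.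
  rewrite [X in (X%:E <= _)%E](_ : _ =
      \sum_(i < n) (y i.+1 ^+ j - y i ^+ j) * (1 - i.+1%:R / n%:R)); last first.
    transitivity (n%:R^-1 * (\sum_(i < n) y i ^+ j + 1) -
        n%:R^-1 * \sum_(i < n) (y i.+1 ^+ j - y i ^+ j)).
      by rewrite telF; ring.
    rewrite sumD mulr_sumr -sumrB; apply: eq_bigr => i _.
    by rewrite -natr1; field; rewrite gt_eqF.
  apply: (@le_trans _ _ (\sum_(i < n) (y i.+1 ^+ j - y i ^+ j)%:E *
      sigma `[y i.+1, +oo[%classic)%E).
    rewrite -sumEFin; apply: lee_sum => i _; rewrite EFinM lee_pmul//.
    - by rewrite lee_fin c0.
    - by rewrite lee_fin subr_ge0 ler_pdivrMr// mul1r ler_nat.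
    - have /andP[q1 _] := yq i.+1 (ltn_ord i).
      rewrite -setCitvl probability_setC; last exact: measurable_itv.
      by rewrite EFinB leeB.
  rewrite -(@integral_step _ (fun i => y i.+1 ^+ j - y i ^+ j)
    (fun i => `[y i.+1, +oo[%classic))//.
  apply: ge0_le_integral => //.
  - move=> t _; rewrite lee_fin sumr_ge0// => i _.
    by rewrite mulr_ge0 ?c0.
  - apply/measurable_EFinP; apply: measurable_sum => i.
    by apply: measurable_funM.
  - move=> t; rewrite /= in_itv /= lee_fin => t01.
    exact: (sum_steps_le fle).
have hi : (\int[sigma]_(t in `[0%R, 1%R]) (t ^+ j)%:E <=
           (n%:R^-1 * (\sum_(i < n) y i ^+ j + 1))%:E)%E.
  rewrite [X in (_ <= X%:E)%E](_ : _ =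
      \sum_(i < n) (y i.+1 ^+ j - y i ^+ j) * (1 - i%:R / n%:R)); last first.
    exact: sumD.
  apply: (@le_trans _ _ (\sum_(i < n) (y i.+1 ^+ j - y i ^+ j)%:E *
      sigma `]y i, +oo[%classic)%E); last first.
    rewrite -sumEFin; apply: lee_sum => i _; rewrite EFinM lee_pmul//.
    - by rewrite lee_fin c0.
    - have /andP[_ q1] := yq i (ltnW (ltn_ord i)).
      rewrite -setCitvl probability_setC; last exact: measurable_itv.
      by rewrite EFinB leeB.
  rewrite -(@integral_step _ (fun i => y i.+1 ^+ j - y i ^+ j)
    (fun i => `]y i, +oo[%classic))//.
  apply: ge0_le_integral => //.
  - by move=> t; rewrite /= in_itv /= lee_fin => /andP[t0 _]; rewrite exprn_ge0.
  - apply/measurable_EFinP; apply: measurable_sum => i.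
    by apply: measurable_funM.
  - move=> t; rewrite /= in_itv /= lee_fin => t01.
    exact: (sum_steps_ge fle).
(* The two finite bounds exclude infinite values. *)
have [m mE] : exists m : R, (\int[sigma]_(t in `[0%R, 1%R]) (t ^+ j)%:E)%E = m%:E.
  by move: lo hi; case: (\int[sigma]_(t in _) _)%E => [m _ _||]//; exists m.
rewrite mE in lo hi *; move: lo hi; rewrite !lee_fin => lo hi.
exists (n%:R * m - \sum_(i < n) y i ^+ j); split.
  rewrite ler_norml; move: lo hi.
  rewrite !ler_pdivrMl ?ler_pdivlMl// => lo hi; apply/andP; split; lra.
by congr EFin; field; rewrite gt_eqF.
Qed.

End MeasureOnUnitInterval.

(** * Existence of quadratures *)

Section Quadrature.
Variable R : realType.
Variable sigma : probability (measurableTypeR R) R.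
Hypothesis sigma01 : sigma `[0, 1]%classic = 1%E.

Lemma fact_pow_le1 (k : nat) (g : R) : 0 <= g -> k%:R * g <= 1 ->
  k`!%:R * g ^+ k <= 1.
Proof.
move=> g0 kg; apply: (@le_trans _ _ ((k%:R * g) ^+ k)); last first.
  by rewrite exprn_ile1// mulr_ge0.
rewrite exprMn ler_wpM2r ?exprn_ge0// -natrX ler_nat.
by rewrite -ffactnn ffact_prod -[X in (_ <= _ ^ X)%N](card_ord k) -prod_nat_const;
  apply: leq_prod => i _; exact: leq_subr.
Qed.

(** Here [g] is the length guaranteed per mass 1/(2(k+2)), a mass that [h] consecutive quantile
    steps carry. Since n <= 2(k+2)h, the condition on n gives the one required of the groups. *)
Lemma quadrature_exists (k n : nat) (g : R) : (0 < k)%N -> 0 <= g ->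
  (forall (x y : R) (a : nat), x <= y -> (a <= k)%N ->
     ((a%:R / (2 * (k%:R + 2)))%:E <= sigma `[x, y]%classic)%E ->
     a%:R * g <= y - x) ->
  (k%:R + 2) * (k%:R * 4 ^+ k) < n%:R * (k`!%:R * g ^+ k) ->
  exists x : 'I_n -> R,
    chebyshev_quadrature sigma k x /\ (forall i, x i \in `[0, 1]).
Proof.
move=> k0 g0 gap hn.
have k2 : 0 < k%:R + 2 :> R by rewrite ltr_wpDl.
have kfg1 : k`!%:R * g ^+ k <= 1.
  (* The interval [0,1] with a = k yields k g <= 1. *)
  apply: fact_pow_le1 => //; rewrite -[leRHS]subr0; apply: gap => //.
  rewrite sigma01 lee_fin ler_pdivrMr ?mulr_gt0// mul1r.
  have : 0 <= k%:R :> R by []; lra.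
have nbig : ((k + 2) * (k * 4 ^ k) < n)%N.
  rewrite -(ltr_nat R) !natrM natrD natrX; apply: (lt_le_trans hn).
  by rewrite ler_piMr.
(* The largest [h] for which the groups and their interlacing points fit among n nodes. *)
pose h := (n %/ (2 * k.+1))%N.
have k4 : (4 * k <= 4 ^ k)%N.
  by elim: (k) => // m IHm; rewrite expnS; case: m IHm => // m; lia.
have hn1 : (2 * h * k.+1 <= n)%N by rewrite mulnAC mulnC leq_divM.
(* As n is large, rounding down costs no more than replacing k+1 by k+2. *)
have hn2 : (n <= 2 * (k + 2) * h)%N.
  have := ltn_ceil n (isT : (0 < 2 * k.+1)%N); rewrite -/h; nia.
have n0 : (0 < n)%N by apply: leq_ltn_trans nbig.
have h0 : (0 < h)%N by case: (h) hn2 => //; rewrite muln0; lia.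
have nR0 : 0 < n%:R :> R by rewrite ltr0n.
have [y [y0 yn y01 yle yq]] := quantile_nodes sigma01 n0.
have ylt i j : (i <= j)%N -> (j <= n)%N -> y i <= y j.
  elim: j => [|j IHj]; first by rewrite leqn0 => /eqP ->.
  rewrite leq_eqVlt => /predU1P[->//|ij] jn.
  by rewrite (le_trans (IHj ij (ltnW jn)))// yle.
have ex j : exists d : R, (0 < j)%N -> `|d| <= 1 /\
    (\int[sigma]_t (t ^+ j)%:E =
     (n%:R^-1 * (\sum_(i < n) y i ^+ j + d))%:E)%E.
  case: (posnP j) => j0; first by exists 0.
  by have [d dP] := moment_quantile sigma01 n0 j0 y0 yn y01 yle yq; exists d.
have {ex} [d dP] := choice ex.
have [| | | | | | |x [x01 xsum]] := @nodes_with_perturbed_power_sums R k n h g y d.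
- exact: h0.
- exact: hn1.
- exact: g0.
- by move=> i i_n; apply: y01; exact: ltnW.
- move=> i j a ak ij jn.
  have i_j : (i <= j)%N by apply: leq_trans ij; exact: leq_addr.
  have yij := ylt _ _ i_j (ltnW jn).
  apply: gap => //.
  have /andP[q1 _] := yq _ (ltnW (leq_ltn_trans i_j jn)).
  have /andP[_ q2] := yq _ (ltnW jn).
  (* It follows that [y_i, y_j] has mass at least (j-i)/n >= a h / n >= a / (2(k+2)). *)
  have : (sigma `]-oo, y j]%classic <=
          sigma `]-oo, y i[%classic + sigma `[y i, y j]%classic)%E.
    rewrite (_ : `]-oo, y j]%classic = `]-oo, y i[%classic `|` `[y i, y j]%classic).
      by apply: measureU2; exact: measurable_itv.
    apply/seteqP; split=> [t|t [|]]; rewrite /= !in_itv /=.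
    - by move=> tj; have [ti|it] := ltP t (y i); [left|right].
    - by move=> ti; apply: (le_trans (ltW ti)).
    - by case/andP.
  move=> /(le_trans q2)/le_trans/(_ (leeD q1 (lexx _))).
  rewrite -leeBlDl// -EFinB; apply: le_trans; rewrite lee_fin.
  rewrite -mulrBl -natrB// ler_pdivrMr ?mulr_gt0// mulrAC ler_pdivlMr//.
  have : ((a * n)%:R <= ((j - i) * (2 * (k + 2)))%:R :> R) by rewrite ler_nat; nia.
  by rewrite !natrM natrD.
- by move=> j /andP[j0 _]; have [] := dP j j0.
- rewrite -(ltr_pM2l k2); apply: (lt_le_trans hn); rewrite [leRHS]mulrA.
  rewrite ler_wpM2r ?mulr_ge0 ?exprn_ge0//.
  by rewrite -natrD -natrM ler_nat; nia.
exists x; split; last by move=> i; rewrite in_itv /= x01.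
(* For j = 0 both sides equal 1; the power sum identities start at j = 1. *)
move=> j jk; case: (posnP j) => [->|j0].
  under eq_integral do rewrite expr0.
  transitivity (1 * sigma setT)%E; first exact: (integral_cst sigma measurableT 1%E).
  rewrite probability_setT mule1.
  under eq_bigr do rewrite expr0.
  by rewrite sumr_const card_ord mulVf ?gt_eqF.
by have [_ ->] := dP j j0; rewrite xsum ?j0.
Qed.

Lemma min_nodes_le (k : nat) (b : int) : 0 <= b ->
  (forall n : nat, b <= n%:Z ->
     exists x : 'I_n -> R,
       chebyshev_quadrature sigma k x /\ (forall i, x i \in `[0, 1])) ->
  (min_nodes sigma k <= (b%:~R)%:E)%E.
Proof.
case: b => // N _ H; apply: ereal_inf_lbound; exists N => //= n Nn.
by have [|x [xq _]] := H n; [rewrite lez_nat | exists x].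
Qed.

End Quadrature.

(** * Numerical estimates for the number of nodes *)

(** A single term of the exponential series is at most its sum. *)
Lemma pow_div_fact_le_exp (R : realType) (x : R) (k : nat) : 0 <= x ->
  x ^+ k <= expR x * k`!%:R.
Proof.
move=> x0; case: k => [|k].
  rewrite expr0 fact0 mulr1 -expR0 ler_expR//.
rewrite -ler_pdivrMr ?ltr0n ?fact_gt0//.
by apply: le_trans (expR_ge1Dxn k x0); rewrite lerDr.
Qed.

(** The case x = k + 2; it stands in for Stirling's formula. *)
Lemma shift2_pow_le_exp_fact (R : realType) (k : nat) :
  (k%:R + 2) ^+ k <= expR 1 ^+ (k + 2) * k`!%:R :> R.
Proof.
have := @pow_div_fact_le_exp R (k%:R + 2) k (addr_ge0 (ler0n _ _) (ler0n _ _)).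
by rewrite -[in expR _]natrD -[in expR _](mulr1 (k + 2)%:R) expRM_natl.
Qed.

(** Under a density bounded by M, mass 1/(2(k+2)) needs length 1/(2(k+2)M), the value of g used
    here. Clearing denominators leaves (k+2) k (8M)^k (k+2)^k; the last power costs e^(k+2) k!, and
    raising 8 to 12 absorbs the first factor. *)
Lemma density_node_count_large (R : realType) (M : R) (k n : nat) : (0 < k)%N -> 1 <= M ->
  75 * expR 4 * k%:R * M * (12 * expR 1 * M) ^+ (k - 1) <= n%:R ->
  (k%:R + 2) * (k%:R * 4 ^+ k) <
    n%:R * (k`!%:R * (2 * (k%:R + 2) * M)^-1 ^+ k).
Proof.
case: k => // m _ M1; set k := m.+1; rewrite subn1 /= => hn.
have M0 : 0 < M by apply: lt_le_trans M1.
have e0 := expR_gt0 (1 : R); have e1 : 1 <= expR (1 : R) by rewrite -expR0 ler_expR.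
have k2 : 0 < k%:R + 2 :> R by rewrite ltr_wpDl.
rewrite exprVn [ltRHS]mulrA ltr_pdivlMr ?exprn_gt0 ?mulr_gt0//.
pose X : R := k%:R * M ^+ k * expR 1 ^+ (m + 3) * k`!%:R.
have X0 : 0 < X by rewrite !mulr_gt0 ?exprn_gt0 ?ltr0n ?fact_gt0.
(* Equality at k = 1; the induction rests on 8(k+3) <= 12(k+2). *)
have p8 : (k%:R + 2) * 8 ^+ k <= 24 * 12 ^+ m :> R.
  have : ((k + 2) * 8 ^ k <= 24 * 12 ^ m)%N.
    rewrite /k; elim: m {hn k k2 X X0} => [//|m IHm].
    by rewrite expnS [in leqRHS]expnS; nia.
  by rewrite -(ler_nat R) !natrM !natrX natrD.
apply: (@le_lt_trans _ _ ((k%:R + 2) * 8 ^+ k * X)).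
  have -> : (k%:R + 2) * (k%:R * 4 ^+ k) * (2 * (k%:R + 2) * M) ^+ k =
     (k%:R + 2) * 8 ^+ k * (k%:R * M ^+ k) * (k%:R + 2) ^+ k :> R.
    rewrite !exprMn (_ : 8 = 4 * 2 :> R) ?exprMn; last by ring.
    by ring.
  rewrite /X -!mulrA; do 4 rewrite ler_wpM2l ?exprn_ge0 ?(ltW k2) ?(ltW M0)//.
  have := shift2_pow_le_exp_fact R k; rewrite (_ : (k + 2 = m + 3)%N)//.
  by rewrite addSn -addnS.
apply: (@lt_le_trans _ _ (75 * expR 1 * 12 ^+ m * X)).
  rewrite ltr_pM2r//; apply: (le_lt_trans p8).
  rewrite ltr_pM2r ?exprn_gt0//; lra.
rewrite /X mulrA ler_wpM2r//; apply: le_trans hn.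
have -> : expR 4 = expR 1 ^+ 4 :> R by rewrite -expRM_natl mulr1.
rewrite (exprS M) !exprMn exprD le_eqVlt; apply/orP; left; apply/eqP. ring.
Qed.

(** Here g is the assumed lower bound on the width at mass 1/(2(k+2)). In g^k the power (k+2)^(beta
    k) splits into (k+2)^((beta-1)k), bounded by the power of k+3, and (k+2)^k, bounded by e^(k+2)
    k!. The constant 8 e^3 comes from k 4^k <= 8^k and k+2 <= 3k. *)
Lemma width_node_count_large (R : realType) (c beta : R) (k n : nat) :
  (0 < k)%N -> 0 < c -> 1 <= beta ->
  (8 * expR 1 ^+ 3 * 2 `^ beta / c) ^+ k * (k%:R + 3) `^ ((beta - 1) * k%:R + 1)
    <= n%:R ->
  (k%:R + 2) * (k%:R * 4 ^+ k) <
    n%:R * (k`!%:R * (c * (2 * (k%:R + 2))^-1 `^ beta) ^+ k).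
Proof.
move=> k0 c0 b1 hn; have k23 : (k + 2 <= 3 * k)%N by lia.
have e0 := expR_gt0 (1 : R); have e1 : 1 <= expR (1 : R) by rewrite -expR0 ler_expR.
have k2 : 0 < k%:R + 2 :> R by rewrite ltr_wpDl.
have k3 : 0 < k%:R + 3 :> R by rewrite ltr_wpDl.
pose P := (k%:R + 2) `^ (beta - 1) : R; pose Q := (k%:R + 3) `^ (beta - 1) : R.
pose T := 2 `^ beta : R.
have P0 : 0 < P by rewrite powR_gt0.
have Q0 : 0 < Q by rewrite powR_gt0.
have T0 : 0 < T by rewrite powR_gt0.
have PQ : P <= Q.
  by rewrite /P /Q ge0_ler_powR ?nnegrE ?(ltW k2) ?(ltW k3) ?subr_ge0// lerD2l; lra.
have QE : (k%:R + 3) `^ ((beta - 1) * k%:R + 1) = Q ^+ k * (k%:R + 3).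
  rewrite powRD ?(gt_eqF k3) ?implybT// powRrM powR_mulrn ?(ltW Q0)//.
  by rewrite powRr1 ?(ltW k3).
have gE : (2 * (k%:R + 2))^-1 `^ beta = (T * ((k%:R + 2) * P))^-1.
  rewrite -powR_inv1 ?mulr_ge0 ?(ltW k2)// -powRrM mulN1r powRN powRM ?(ltW k2)//.
  rewrite -[in X in _ * X](subrK 1 beta) powRD ?(gt_eqF k2) ?implybT//.
  by rewrite powRr1 ?(ltW k2)// [_ * (k%:R + 2)]mulrC.
rewrite gE expr_div_n 2![ltRHS]mulrA ltr_pdivlMr ?exprn_gt0 ?mulr_gt0//.
rewrite QE in hn.
apply: (@lt_le_trans _ _ ((8 * expR 1 ^+ 3 * T / c) ^+ k * (Q ^+ k * (k%:R + 3))
   * (k`!%:R * c ^+ k))); last first.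
  by rewrite [leLHS]mulrA ler_wpM2r ?exprn_ge0 ?(ltW c0)// ler_wpM2r.
pose X := T ^+ k * Q ^+ k * k`!%:R.
have X0 : 0 < X by rewrite !mulr_gt0 ?exprn_gt0 ?ltr0n ?fact_gt0.
have -> : (8 * expR 1 ^+ 3 * T / c) ^+ k * (Q ^+ k * (k%:R + 3)) * (k`!%:R * c ^+ k)
    = (k%:R + 3) * (8 ^+ k * expR 1 ^+ (3 * k)) * X.
  rewrite expr_div_n exprM !exprMn /X; field.
  by rewrite expf_neq0// gt_eqF.
apply: (@le_lt_trans _ _ ((k%:R + 2) * (k%:R * 4 ^+ k * expR 1 ^+ (k + 2)) * X)).
  have -> : (k%:R + 2) * (k%:R * 4 ^+ k) * (T * ((k%:R + 2) * P)) ^+ k =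
      (k%:R + 2) * (k%:R * 4 ^+ k) * T ^+ k * (P ^+ k * (k%:R + 2) ^+ k).
    by rewrite !exprMn; ring.
  have -> : (k%:R + 2) * (k%:R * 4 ^+ k * expR 1 ^+ (k + 2)) * X =
      (k%:R + 2) * (k%:R * 4 ^+ k) * T ^+ k * (Q ^+ k * (expR 1 ^+ (k + 2) * k`!%:R)).
    by rewrite /X; ring.
  rewrite ler_wpM2l ?mulr_ge0 ?exprn_ge0 ?(ltW T0) ?(ltW k2)//.
  apply: ler_pM; rewrite ?exprn_ge0 ?(ltW P0) ?(ltW k2)//; last first.
    exact: shift2_pow_le_exp_fact.
  by rewrite lerXn2r ?nnegrE ?(ltW P0) ?(ltW Q0).
rewrite ltr_pM2r//.
apply: (@lt_le_trans _ _ ((k%:R + 3) * (k%:R * 4 ^+ k * expR 1 ^+ (k + 2)))).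
  by rewrite ltr_pM2r ?mulr_gt0 ?exprn_gt0 ?ltr0n// ltrD2l; lra.
rewrite ler_wpM2l ?(ltW k3)//; apply: ler_pM; rewrite ?mulr_ge0 ?exprn_ge0 ?(ltW e0)//.
  have : (k * 4 ^ k <= 8 ^ k)%N.
    by rewrite (_ : 8 = 2 * 4)%N// expnMn leq_mul2r (ltnW (ltn_expl k _)) ?orbT.
  by rewrite -(ler_nat R) natrM !natrX.
by rewrite ler_weXn2l.
Qed.

(** * Application to bounded densities and to power lower bounds on the width *)

Theorem theorem1p4 (R : realType) :
  (forall (sigma : probability (measurableTypeR R) R) (M : R),
     sigma `[0, 1]%classic = 1%E ->
     sigma `<< (@lebesgue_measure R) ->
     (ess_sup (@lebesgue_measure R)
        ('d (charge_of_finite_measure sigma) '/d (@lebesgue_measure R))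
      <= M%:E)%E ->
     forall k : nat, (2 <= k)%N ->
     let bound : int :=
       Num.ceil (75 * expR 4 * k%:R * M * (12 * expR 1 * M) ^+ (k - 1)) in
     (min_nodes sigma k <= (bound%:~R)%:E)%E /\
     forall n : nat, bound <= n%:Z ->
       exists x : 'I_n -> R,
         chebyshev_quadrature sigma k x /\ (forall i, x i \in `[0, 1]))
  /\
  (forall c beta : R, 0 < c -> 1 <= beta ->
   exists2 alpha : R, 0 < alpha &
   forall sigma : probability (measurableTypeR R) R,
     sigma `[0, 1]%classic = 1%E ->
     (forall delta : R, 0 < delta < 1 ->
        c * delta `^ beta <= min_width sigma delta) ->
     forall k : nat, (2 <= k)%N ->
     let bound : int :=
       Num.ceil (alpha ^+ k * (k%:R + 3) `^ ((beta - 1) * k%:R + 1)) in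
     (min_nodes sigma k <= (bound%:~R)%:E)%E /\
     forall n : nat, bound <= n%:Z ->
       exists x : 'I_n -> R,
         chebyshev_quadrature sigma k x /\ (forall i, x i \in `[0, 1])).
Proof.
split=> [sigma M sigma01 ac fM k k2 bound|c beta c0 b1].
  have dens := bounded_density_le ac fM.
  (* The interval [0,1] has mass 1 and length 1. *)
  have M1 : 1 <= M.
    by have := dens 0 1 ler01; rewrite sigma01 subr0 mulr1 lee_fin.
  have M0 : 0 < M by apply: lt_le_trans M1.
  have H n : bound <= n%:Z -> exists x : 'I_n -> R,
      chebyshev_quadrature sigma k x /\ (forall i, x i \in `[0, 1]).
    rewrite /bound ceil_le_int => hn.
    have p0 : 0 < 2 * (k%:R + 2) :> R by rewrite mulr_gt0// ltr_wpDl.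
    apply: (quadrature_exists sigma01 _ _ _ (density_node_count_large (ltnW k2) M1 hn)).
    - exact: ltnW.
    - by rewrite invr_ge0 mulr_ge0 ?(ltW p0) ?(ltW M0).
    move=> x y a xy _ /le_trans/(_ (dens _ _ xy)); rewrite lee_fin => aM.
    by rewrite invfM mulrA ler_pdivrMr// [leRHS]mulrC.
  split=> //; apply: min_nodes_le H; rewrite /bound ceil_ge0//.
  apply: (lt_le_trans (ltrN10 _)).
  by rewrite !mulr_ge0 ?exprn_ge0 ?mulr_ge0 ?expR_ge0 ?(ltW M0).
exists (8 * expR 1 ^+ 3 * 2 `^ beta / c).
  by rewrite divr_gt0// !mulr_gt0 ?exprn_gt0 ?expR_gt0 ?powR_gt0.
move=> sigma sigma01 width k k2 bound.
have H n : bound <= n%:Z -> exists x : 'I_n -> R,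
    chebyshev_quadrature sigma k x /\ (forall i, x i \in `[0, 1]).
  rewrite /bound ceil_le_int => hn.
  have p0 : 0 < 2 * (k%:R + 2) :> R by rewrite mulr_gt0// ltr_wpDl.
  apply: (quadrature_exists sigma01 _ _ _ (width_node_count_large (ltnW k2) c0 b1 hn)).
  - exact: ltnW.
  - by rewrite mulr_ge0 ?powR_ge0 ?(ltW c0).
  (* The width is controlled for positive mass only, so a = 0 is separate. *)
  move=> x y a xy ak sxy; case: (posnP a) => [->|a0].
    by rewrite mul0r subr_ge0.
  have d01 : 0 < (a%:R / (2 * (k%:R + 2)) : R) < 1.
    rewrite divr_gt0 ?ltr0n//= ltr_pdivrMr// mul1r -natrD -natrM ltr_nat; lia.
  (* Since a >= 1 and beta >= 1, a <= a^beta: the power bound grows at least linearly in a. *)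
  apply: (@le_trans _ _ (c * (a%:R / (2 * (k%:R + 2))) `^ beta)).
    rewrite mulrCA ler_wpM2l ?(ltW c0)// powRM ?invr_ge0 ?(ltW p0)//.
    rewrite ler_wpM2r ?powR_ge0// -[leLHS]powRr1// ler_powR// ler1n//.
  apply: (le_trans (width _ d01)); apply: ge_inf.
    by exists 0 => r [u [v [-> _]]].
  by exists x, y; split=> //; rewrite distrC ger0_norm// subr_ge0.
split=> //; apply: min_nodes_le H; rewrite /bound ceil_ge0//.
apply: (lt_le_trans (ltrN10 _)).
by rewrite mulr_ge0 ?powR_ge0// exprn_ge0// divr_ge0 ?(ltW c0).
Qed.
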